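(* For every integer $n\geq 1$, the following identities hold in $\mathbb{Z}[x]$: $$F_n(x)= T_{n-1}(x)-\sum_{k=1}^{n-2}\bigl(xT_{n-1-k}(x)-2T_{n-2-k}(x)\bigr)F_k(x),$$ $$F_{n}(x)+xF_{n-1}(x)= U_{n-1}(x)-\sum_{k=1}^{n-2}\bigl(xU_{n-1-k}(x)-2U_{n-2-k}(x)\bigr)F_{k}(x).$$
   Context: The Chebyshev polynomials of the first kind $T_n(x)$ and of the second kind $U_n(x)$ are defined by $T_0(x)=1$, $T_1(x)=x$, $T_{n+1}(x)=2xT_n(x)-T_{n-1}(x)$, and $U_0(x)=1$, $U_1(x)=2x$, $U_{n+1}(x)=2xU_n(x)-U_{n-1}(x)$ for $n\ge 1$. The (Catalan) Fibonacci polynomials $F_n(x)$ are defined by $F_0(x)=0$, $F_1(x)=1$, $F_n(x)=xF_{n-1}(x)+F_{n-2}(x)$ for $n\geq 2$. A sum whose upper limit is smaller than its lower limit is $0$. *)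

(* Defs.v *)
From HB Require Import structures.
From mathcomp Require Import all_boot all_order all_algebra.
Set Implicit Arguments.
Unset Strict Implicit.
Unset Printing Implicit Defensive.
Import GRing.Theory.
Local Open Scope ring_scope.

Fixpoint chebT (n : nat) : {poly int} :=
  match n with
  | 0 => 1
  | 1 => 'X
  | (m.+1 as p).+1 => 2%:R * 'X * chebT p - chebT m
  end.

Fixpoint chebU (n : nat) : {poly int} :=
  match n with
  | 0 => 1
  | 1 => 2%:R * 'X
  | (m.+1 as p).+1 => 2%:R * 'X * chebU p - chebU m
  end.

Fixpoint fibp (n : nat) : {poly int} :=
  match n with
  | 0 => 0
  | 1 => 1
  | (m.+1 as p).+1 => 'X * fibp p + fibp m
  end.

(* Main.v *)
(** For any sequence [C] satisfying the Chebyshev recurrence, put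
    [G_k = C_j F_(k+1) + (C_(j+1) - x C_j) F_k] with [j + k = m + 1].  The two
    recurrences give [G_k - G_(k+1) = (x C_j - 2 C_(j-1)) F_k], so the sum
    telescopes.  The boundary term [C_1 - x C_0] is [0] for [T] and [x] for [U]. *)
Require Import Defs.
From mathcomp Require Import all_boot all_order all_algebra.
From mathcomp Require Import ring.
Set Implicit Arguments.
Unset Strict Implicit.
Unset Printing Implicit Defensive.
Import GRing.Theory.
Local Open Scope ring_scope.

Lemma fibpSS (n : nat) : fibp n.+2 = 'X * fibp n.+1 + fibp n.
Proof. by []. Qed.

Lemma sum_cheb_fibp (C : nat -> {poly int})
    (CSS : forall j, C j.+2 = 2%:R * 'X * C j.+1 - C j) (m : nat) :
  \sum_(1 <= k < m.+1) ('X * C (m.+1 - k)%N - 2%:R * C (m - k)%N) * fibp k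
  = C m.+1 - (C 0 * fibp m.+2 + (C 1 - 'X * C 0) * fibp m.+1).
Proof.
pose G k := C (m.+1 - k)%N * fibp k.+1
            + (C (m.+2 - k)%N - 'X * C (m.+1 - k)%N) * fibp k.
(* The sign turns the differences [G k - G k.+1] into the increments that telescoping expects. *)
rewrite (@telescope_sumr_eq _ 1 m.+1 (fun k => - G k)) //; last first.
  move=> k /andP[_ lekm]; rewrite /G subSS.
  (* Since [k <= m], writing [m = j + k] removes truncated subtraction; the indices become [j],
     [j.+1], [j.+2], so [CSS] applies. *)
  have [j ->] : exists j, m = (j + k)%N by exists (m - k)%N; rewrite subnK.
  by rewrite subSS -!addSn !addnK CSS fibpSS; ring.
(* As [fibp 2] is ['X] and [fibp 1] is [1], the ['X * C m] terms in [G 1] cancel, leaving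
   [C m.+1]. *)
by rewrite /G subnn subSnn !subSS !subn0 (fibpSS 0) /=; ring.
Qed.

Theorem theorem1 (n : nat) (hn : (1 <= n)%N) :
  fibp n = chebT (n - 1)
    - \sum_(1 <= k < (n - 2).+1)
        ('X * chebT (n - 1 - k) - 2%:R * chebT (n - 2 - k)) * fibp k
  /\
  fibp n + 'X * fibp (n - 1) = chebU (n - 1)
    - \sum_(1 <= k < (n - 2).+1)
        ('X * chebU (n - 1 - k) - 2%:R * chebU (n - 2 - k)) * fibp k.
Proof.
case: n hn => [|[|m]] // _.
  (* Case [n = 1]: [n - 2] truncates to [0], so both sums are empty. *)
  by rewrite !big_geq //=; split; ring.
have -> : (m.+2 - 1 = m.+1)%N by rewrite subn1.
have -> : (m.+2 - 2 = m)%N by rewrite subn2.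
rewrite !sum_cheb_fibp //.
have -> : chebT 0 = 1 by [].
have -> : chebT 1 = 'X by [].
have -> : chebU 0 = 1 by [].
have -> : chebU 1 = 2%:R * 'X by [].
by split; ring.
Qed.
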